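(* Let $G$ be a finite cyclic group of order $N$, $\mathbf{k}$ a commutative $\mathbb{Q}$-algebra, and $\iota:G\to\mathbb{C}^\times$ a group embedding. There exists a topological $\mathbf{k}$-algebra isomorphism $\mathrm{iso}^{\mathcal W,\iota}:\widehat{\mathcal W}^{\mathrm B}_N\to\widehat{\mathcal W}^{\mathrm{DR}}_G$ such that $j^{\mathrm{DR}}\circ\mathrm{iso}^{\mathcal W,\iota}=\mathrm{iso}^{\mathcal V,\iota}\circ j^{\mathrm B}$, where $j^{\mathrm B}:\widehat{\mathcal W}^{\mathrm B}_N\hookrightarrow\widehat{\mathcal V}^{\mathrm B}_N$ and $j^{\mathrm{DR}}:\widehat{\mathcal W}^{\mathrm{DR}}_G\hookrightarrow\widehat{\mathcal V}^{\mathrm{DR}}_G$ are the canonical injections.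
   Context: $\widehat{\mathcal V}^{\mathrm{DR}}_G$ is the complete graded $\mathbf{k}$-algebra generated by $e_0,e_1$ (degree $1$) and the elements of $G$ (degree $0$), with relations: the product of $g,h\in G$ is $gh$, the unit of $G$ is $1$, and $ge_0=e_0g$ for $g\in G$. $\widehat{\mathcal W}^{\mathrm{DR}}_G:=\mathbf{k}\oplus\widehat{\mathcal V}^{\mathrm{DR}}_Ge_1$ is a complete graded subalgebra. $F_2$ is the free group on $X_0,X_1$, $\mu_N\subset\mathbb{C}^\times$ is the group of $N$-th roots of unity, $\mathcal V^{\mathrm B}_N:=\mathbf{k}F_2$ with filtration $\mathcal F^m\mathcal V^{\mathrm B}_N=\mathcal I^m$ ($\mathcal I^0=\mathbf{k}F_2$), where $\mathcal I$ is the kernel of the algebra morphism $\mathbf{k}F_2\to\mathbf{k}\mu_N$ induced by $X_0\mapsto e^{2\pi i/N}$, $X_1\mapsto1$; $\widehat{\mathcal V}^{\mathrm B}_N:=\varprojlim\mathcal V^{\mathrm B}_N/\mathcal F^m\mathcal V^{\mathrm B}_N$. $\mathcal W^{\mathrm B}_N:=\mathbf{k}\oplus\mathcal V^{\mathrm B}_N(X_1-1)$, filtered by $\mathcal F^m\mathcal W^{\mathrm B}_N=\mathcal W^{\mathrm B}_N\cap\mathcal F^m\mathcal V^{\mathrm B}_N$, and $\widehat{\mathcal W}^{\mathrm B}_N:=\varprojlim\mathcal W^{\mathrm B}_N/\mathcal F^m\mathcal W^{\mathrm B}_N$; $j^{\mathrm B}$ is the injective topological algebra morphism induced by $\mathcal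 W^{\mathrm B}_N\subset\mathcal V^{\mathrm B}_N$. $\mathrm{iso}^{\mathcal V,\iota}:\widehat{\mathcal V}^{\mathrm B}_N\to\widehat{\mathcal V}^{\mathrm{DR}}_G$ is the unique topological algebra isomorphism with $X_0\mapsto\exp(\frac1Ne_0)g_\iota$, $X_1\mapsto\exp(e_1)$, where $g_\iota=\iota^{-1}(e^{2\pi i/N})$. *)

(* Defs.v *)
From HB Require Import structures.
From mathcomp Require Import all_boot all_order all_algebra all_fingroup all_solvable.
From mathcomp Require Import generic_quotient finmap complex.
From mathcomp Require Import all_classical all_reals all_analysis.

Set Implicit Arguments.
Unset Strict Implicit.
Unset Printing Implicit Defensive.

Import Order.TTheory GRing.Theory Num.Theory.
Local Open Scope classical_set_scope.
Local Open Scope quotient_scope.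
Local Open Scope ring_scope.

(* Unital associative algebras over a commutative ring, given by the structure
   morphism [kmap : K -> A] with central image.  MathComp's [algType] is not
   usable here: it excludes the zero ring, whereas a quotient [A / F^0] in an
   inverse system is zero. *)
HB.mixin Record PzRing_isKAlgebra (K : comPzRingType) A of GRing.PzRing A := {
  kmap : K -> A;
  kmap_zmod_morphism : zmod_morphism kmap;
  kmap_monoid_morphism : monoid_morphism kmap;
  kmapC : forall (a : K) (x : A), kmap a * x = x * kmap a
}.

#[short(type="kAlgType")]
HB.structure Definition KAlgebra (K : comPzRingType) :=
  {A of PzRing_isKAlgebra K A & GRing.PzRing A}.

#[short(type="topKAlgType")]
HB.structure Definition TopKAlgebra (K : comPzRingType) :=
  {A of KAlgebra K A & Topological A}.

Notation "a %:k" := (kmap a) (at level 2, format "a %:k") : ring_scope.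

Section Morphisms.
Variable K : comPzRingType.

HB.instance Definition _ (A : kAlgType K) :=
  GRing.isZmodMorphism.Build K A (@kmap K A) kmap_zmod_morphism.
HB.instance Definition _ (A : kAlgType K) :=
  GRing.isMonoidMorphism.Build K A (@kmap K A) kmap_monoid_morphism.

Definition alg_morphism (A B : kAlgType K) (f : A -> B) : Prop :=
  [/\ zmod_morphism f, monoid_morphism f & forall a : K, f a%:k = a%:k].

Definition top_alg_iso (A B : topKAlgType K) (f : A -> B) : Prop :=
  [/\ alg_morphism f, continuous f &
      exists g : B -> A, [/\ cancel f g, cancel g f & continuous g]].

End Morphisms.

Section Ideals.
Variables (K : comPzRingType) (A : kAlgType K).

Definition is_ideal (J : set A) : Prop :=
  [/\ J 0, forall x y, J x -> J y -> J (x + y) &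
      forall a x b, J x -> J (a * x * b)].

Record ideal := Ideal { ideal_set :> A -> Prop; idealP : is_ideal ideal_set }.

Implicit Types (J : ideal) (S : set A).

Lemma ideal0 J : J 0. Proof. by case: (idealP J). Qed.

Lemma idealD J x y : J x -> J y -> J (x + y).
Proof. by case: (idealP J) => _ + _; apply. Qed.

Lemma idealMl J a x : J x -> J (a * x).
Proof. by case: (idealP J) => _ _ H /(H a _ 1); rewrite mulr1. Qed.

Lemma idealMr J x b : J x -> J (x * b).
Proof. by case: (idealP J) => _ _ H /(H 1 _ b); rewrite mul1r. Qed.

Lemma idealN J x : J x -> J (- x).
Proof. by rewrite -mulN1r; apply: idealMl. Qed.

Lemma idealB J x y : J x -> J y -> J (x - y).
Proof. by move=> Jx /idealN; apply: idealD. Qed.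

Lemma is_ideal_smallest S : is_ideal (smallest is_ideal S).
Proof.
split.
- by move=> J [[]].
- by move=> x y Sx Sy J JP; case: (JP) => -[_ + _] _; apply; [exact: Sx|exact: Sy].
- by move=> a x b Sx J JP; case: (JP) => -[_ _ +] _; apply; exact: Sx.
Qed.

Definition ideal_gen S : ideal := Ideal (is_ideal_smallest S).

Lemma is_idealT : is_ideal setT. Proof. by []. Qed.

Definition idealT : ideal := Ideal is_idealT.

Definition ideal_mul (I J : ideal) : ideal :=
  ideal_gen [set z | exists x y, [/\ I x, J y & z = x * y]].

Fixpoint ideal_exp (I : ideal) (m : nat) : ideal :=
  if m is m'.+1 then ideal_mul I (ideal_exp I m') else idealT.

End Ideals.

Arguments ideal_gen {K A} S.
Arguments ideal_exp {K A} I m.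

Section Quotient.
Variables (K : comPzRingType) (A : kAlgType K) (J : ideal A).

Definition quot_rel (x y : A) : bool := `[< J (x - y) >].

Lemma quot_relP : equiv_class_of quot_rel.
Proof.
split=> [x|x y|y x z].
- by apply/asboolP; rewrite subrr; apply: ideal0.
- by apply/asboolP/asboolP => /idealN; rewrite opprB.
- move=> /asboolP Jxy /asboolP Jyz; apply/asboolP.
  by rewrite -[x](addrNK y) -addrA; apply: idealD.
Qed.

Canonical quot_equiv := EquivRelPack quot_relP.
Canonical quot_encModRel := defaultEncModRel quot_rel.

Definition quot := {eq_quot quot_rel}.

HB.instance Definition _ := EqQuotient.on quot.
HB.instance Definition _ := Choice.on quot.

Definition qpi (x : A) : quot := \pi_quot x.

Lemma qpiE x y : qpi x = qpi y <-> J (x - y).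
Proof.
split=> [/eqP|H]; last (apply/eqP; move: H).
  by rewrite /qpi piE => /asboolP.
by rewrite /qpi piE => ?; apply/asboolP.
Qed.

Lemma qpi_repr (x : quot) : qpi (repr x) = x. Proof. exact: reprK. Qed.

Lemma repr_qpi x : J (repr (qpi x) - x).
Proof. by apply/qpiE; exact: qpi_repr. Qed.

Lemma qpi_ind (P : quot -> Prop) : (forall x, P (qpi x)) -> forall x, P x.
Proof. by move=> H x; rewrite -(qpi_repr x). Qed.

Definition quot_add (x y : quot) : quot := qpi (repr x + repr y).
Definition quot_opp (x : quot) : quot := qpi (- repr x).
Definition quot_mul (x y : quot) : quot := qpi (repr x * repr y).

Lemma qpi_add x y : quot_add (qpi x) (qpi y) = qpi (x + y).
Proof. by apply/qpiE; rewrite opprD addrACA; apply: idealD; apply: repr_qpi. Qed.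

Lemma qpi_opp x : quot_opp (qpi x) = qpi (- x).
Proof. by apply/qpiE; rewrite -opprD; apply/idealN/repr_qpi. Qed.

Lemma qpi_mul x y : quot_mul (qpi x) (qpi y) = qpi (x * y).
Proof.
apply/qpiE; set x' := repr _; set y' := repr _.
rewrite (_ : _ - _ = (x' - x) * y' + x * (y' - y)); last first.
  by rewrite mulrBl mulrBr addrA subrK.
by apply: idealD; [apply: idealMr|apply: idealMl]; apply: repr_qpi.
Qed.

Let qE := (qpi_add, qpi_opp, qpi_mul).

Lemma quot_addA : associative quot_add.
Proof. by elim/qpi_ind=> x; elim/qpi_ind=> y; elim/qpi_ind=> z; rewrite !qE addrA. Qed.

Lemma quot_addC : commutative quot_add.
Proof. by elim/qpi_ind=> x; elim/qpi_ind=> y; rewrite !qE addrC. Qed.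

Lemma quot_add0 : left_id (qpi 0) quot_add.
Proof. by elim/qpi_ind=> x; rewrite !qE add0r. Qed.

Lemma quot_addN : left_inverse (qpi 0) quot_opp quot_add.
Proof. by elim/qpi_ind=> x; rewrite !qE addNr. Qed.

HB.instance Definition _ := GRing.isZmodule.Build quot
  quot_addA quot_addC quot_add0 quot_addN.

Lemma quot_mulA : associative quot_mul.
Proof. by elim/qpi_ind=> x; elim/qpi_ind=> y; elim/qpi_ind=> z; rewrite !qE mulrA. Qed.

Lemma quot_mul1 : left_id (qpi 1) quot_mul.
Proof. by elim/qpi_ind=> x; rewrite !qE mul1r. Qed.

Lemma quot_mulr1 : right_id (qpi 1) quot_mul.
Proof. by elim/qpi_ind=> x; rewrite !qE mulr1. Qed.

Lemma quot_mulDl : left_distributive quot_mul quot_add.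
Proof. by elim/qpi_ind=> x; elim/qpi_ind=> y; elim/qpi_ind=> z; rewrite !qE mulrDl. Qed.

Lemma quot_mulDr : right_distributive quot_mul quot_add.
Proof. by elim/qpi_ind=> x; elim/qpi_ind=> y; elim/qpi_ind=> z; rewrite !qE mulrDr. Qed.

HB.instance Definition _ := GRing.Zmodule_isPzRing.Build quot
  quot_mulA quot_mul1 quot_mulr1 quot_mulDl quot_mulDr.

Definition quot_kmap (a : K) : quot := qpi a%:k.

Lemma quot_kmap_zmod : zmod_morphism quot_kmap.
Proof. by move=> a b; rewrite /quot_kmap rmorphB -qpi_add -qpi_opp. Qed.

Lemma quot_kmap_monoid : monoid_morphism quot_kmap.
Proof. by split=> [|a b]; rewrite /quot_kmap (rmorph1, rmorphM) // -qpi_mul. Qed.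

Lemma quot_kmapC (a : K) (x : quot) : quot_kmap a * x = x * quot_kmap a.
Proof. by elim/qpi_ind: x => x; rewrite /GRing.mul /= !qE kmapC. Qed.

HB.instance Definition _ := PzRing_isKAlgebra.Build K quot
  quot_kmap_zmod quot_kmap_monoid quot_kmapC.

Lemma qpi0 : qpi 0 = 0. Proof. by []. Qed.
Lemma qpi1 : qpi 1 = 1. Proof. by []. Qed.
Lemma qpiD x y : qpi (x + y) = qpi x + qpi y. Proof. by rewrite -qpi_add. Qed.
Lemma qpiN x : qpi (- x) = - qpi x. Proof. by rewrite -qpi_opp. Qed.
Lemma qpiM x y : qpi (x * y) = qpi x * qpi y. Proof. by rewrite -qpi_mul. Qed.
Lemma qpiK a : qpi a%:k = a%:k. Proof. by []. Qed.

End Quotient.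

Arguments qpi {K A} J x.

Section Completion.
Variables (K : comPzRingType) (A : kAlgType K).

Record filtration := Filtration {
  fil :> nat -> ideal A;
  fil_dec : forall m x, fil m.+1 x -> fil m x
}.

Variable F : filtration.

Definition qtrans m (x : quot (F m.+1)) : quot (F m) := qpi (F m) (repr x).

Lemma qtransE m x : qtrans (qpi (F m.+1) x) = qpi (F m) x.
Proof. by apply/qpiE/fil_dec/repr_qpi. Qed.

(* The inverse limit of the quotients [A / F m]. *)
Record completion := Completion {
  cproj : forall m, quot (F m);
  cprojP : forall m, qtrans (cproj m.+1) = cproj m
}.

HB.instance Definition _ := gen_eqMixin completion.
HB.instance Definition _ := gen_choiceMixin completion.

Lemma completion_ext x y : (forall m, cproj x m = cproj y m) -> x = y.
Proof.
case: x y => [x xP] [y yP] /= xy.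
have {}xy : x = y by apply: functional_extensionality_dep.
by case: y / xy yP => yP; congr Completion; exact: Prop_irrelevance.
Qed.

Fact compl_in_subproof a m :
  qtrans ((fun m => qpi (F m) a) m.+1) = (fun m => qpi (F m) a) m.
Proof. exact: qtransE. Qed.

Definition compl_in (a : A) : completion := Completion (compl_in_subproof a).

Fact compl_add_subproof (x y : completion) m :
  qtrans ((fun m => cproj x m + cproj y m) m.+1) = cproj x m + cproj y m.
Proof.
rewrite -(cprojP x m) -(cprojP y m) /=; elim/qpi_ind: (cproj x _) => a.
by elim/qpi_ind: (cproj y _) => b; rewrite -qpiD !qtransE qpiD.
Qed.

Definition compl_add x y : completion := Completion (compl_add_subproof x y).

Fact compl_opp_subproof (x : completion) m :
  qtrans ((fun m => - cproj x m) m.+1) = - cproj x m.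
Proof.
by rewrite -(cprojP x m) /=; elim/qpi_ind: (cproj x _) => a; rewrite -qpiN !qtransE qpiN.
Qed.

Definition compl_opp x : completion := Completion (compl_opp_subproof x).

Fact compl_mul_subproof (x y : completion) m :
  qtrans ((fun m => cproj x m * cproj y m) m.+1) = cproj x m * cproj y m.
Proof.
rewrite -(cprojP x m) -(cprojP y m) /=; elim/qpi_ind: (cproj x _) => a.
by elim/qpi_ind: (cproj y _) => b; rewrite -qpiM !qtransE qpiM.
Qed.

Definition compl_mul x y : completion := Completion (compl_mul_subproof x y).

Lemma compl_addA : associative compl_add.
Proof. by move=> x y z; apply: completion_ext => m /=; rewrite addrA. Qed.

Lemma compl_addC : commutative compl_add.
Proof. by move=> x y; apply: completion_ext => m /=; rewrite addrC. Qed.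

Lemma compl_add0 : left_id (compl_in 0) compl_add.
Proof. by move=> x; apply: completion_ext => m /=; rewrite qpi0 add0r. Qed.

Lemma compl_addN : left_inverse (compl_in 0) compl_opp compl_add.
Proof. by move=> x; apply: completion_ext => m /=; rewrite qpi0 addNr. Qed.

HB.instance Definition _ := GRing.isZmodule.Build completion
  compl_addA compl_addC compl_add0 compl_addN.

Lemma compl_mulA : associative compl_mul.
Proof. by move=> x y z; apply: completion_ext => m /=; rewrite mulrA. Qed.

Lemma compl_mul1 : left_id (compl_in 1) compl_mul.
Proof. by move=> x; apply: completion_ext => m /=; rewrite qpi1 mul1r. Qed.

Lemma compl_mulr1 : right_id (compl_in 1) compl_mul.
Proof. by move=> x; apply: completion_ext => m /=; rewrite qpi1 mulr1. Qed.

Lemma compl_mulDl : left_distributive compl_mul compl_add.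
Proof. by move=> x y z; apply: completion_ext => m /=; rewrite mulrDl. Qed.

Lemma compl_mulDr : right_distributive compl_mul compl_add.
Proof. by move=> x y z; apply: completion_ext => m /=; rewrite mulrDr. Qed.

HB.instance Definition _ := GRing.Zmodule_isPzRing.Build completion
  compl_mulA compl_mul1 compl_mulr1 compl_mulDl compl_mulDr.

Definition compl_kmap (a : K) : completion := compl_in a%:k.

Lemma compl_kmap_zmod : zmod_morphism compl_kmap.
Proof. by move=> a b; apply: completion_ext => m /=; rewrite rmorphB qpiD qpiN. Qed.

Lemma compl_kmap_monoid : monoid_morphism compl_kmap.
Proof.
split=> [|a b]; apply: completion_ext => m /=; first by rewrite rmorph1.
by rewrite rmorphM qpiM.
Qed.

Lemma compl_kmapC (a : K) (x : completion) : compl_kmap a * x = x * compl_kmap a.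
Proof. by apply: completion_ext => m /=; rewrite qpiK kmapC. Qed.

HB.instance Definition _ := PzRing_isKAlgebra.Build K completion
  compl_kmap_zmod compl_kmap_monoid compl_kmapC.

(* The inverse limit topology for the discrete topology on each [A / F m]. *)
Definition compl_nbhs (x : completion) : set_system completion :=
  filter_from setT (fun m => [set y | cproj y m = cproj x m]).

HB.instance Definition _ := isPointed.Build completion 0.
HB.instance Definition _ := hasNbhs.Build completion compl_nbhs.

Lemma cproj_le (x y : completion) m n : (m <= n)%N ->
  cproj x n = cproj y n -> cproj x m = cproj y m.
Proof.
move=> /subnK <-; elim: (n - m)%N => //= d IH xy; apply: IH.
by rewrite -(cprojP x) -(cprojP y) xy.
Qed.

Lemma compl_nbhs_filter (x : completion) : ProperFilter (nbhs x).
Proof.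
apply: filter_from_proper; last by move=> m _; exists x.
apply: filter_from_filter; first by exists 0%N.
move=> m n _ _; exists (maxn m n) => // y /= xy; split.
  by apply: cproj_le xy; exact: leq_maxl.
by apply: cproj_le xy; exact: leq_maxr.
Qed.

Lemma compl_nbhs_singleton (x : completion) (S : set completion) :
  nbhs x S -> S x.
Proof. by case=> m _; apply. Qed.

Lemma compl_nbhs_nbhs (x : completion) (S : set completion) :
  nbhs x S -> nbhs x (nbhs^~ S).
Proof.
by case=> m _ mS; exists m => // y /= yx; exists m => // z /= zy; apply: mS; rewrite /= zy.
Qed.

HB.instance Definition _ := Nbhs_isNbhsTopological.Build completion
  compl_nbhs_filter compl_nbhs_singleton compl_nbhs_nbhs.

End Completion.

Arguments compl_in {K A} F a.

Section CompletionMap.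
Variables (K : comPzRingType) (A B : kAlgType K).
Variables (F : filtration A) (E : filtration B) (f : A -> B).
Hypotheses (fB : zmod_morphism f) (fF : forall m x, F m x -> E m (f x)).

Fact compl_map_subproof (x : completion F) m :
  qtrans ((fun m => qpi (E m) (f (repr (cproj x m)))) m.+1) =
  qpi (E m) (f (repr (cproj x m))).
Proof.
rewrite qtransE; apply/qpiE; rewrite -fB; apply: fF; apply/qpiE.
by rewrite -/(qtrans _) cprojP qpi_repr.
Qed.

Definition compl_map (x : completion F) : completion E :=
  Completion (compl_map_subproof x).

End CompletionMap.

Section MonoidAlgebra.
Local Open Scope fset_scope.
Local Open Scope ring_scope.
Variables (K : comPzRingType) (M : monoidType).

(* The monoid algebra of [M]; it is the group algebra when [M] is a group.
   (The library's [malg] excludes monoids with nontrivial units.) *)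
Record monAlg := MonAlg { mcoef : {fsfun M -> K with 0} }.

HB.instance Definition _ := [isNew for mcoef].
HB.instance Definition _ := [Choice of monAlg by <:].

Implicit Types (x y z : monAlg) (m : M) (c : K) (D : {fset M}).

Definition msupp x : {fset M} := finsupp (mcoef x).

Definition mU c m : monAlg := MonAlg [fsfun n in [fset m] => c | 0].

Lemma monAlgP x y : (forall m, mcoef x m = mcoef y m) <-> x = y.
Proof.
by case: x y => [x] [y]; split=> [h|->//]; congr MonAlg; apply/fsfunP/h.
Qed.

Lemma mcoef_out x m : m \notin msupp x -> mcoef x m = 0.
Proof. exact: fsfun_dflt. Qed.

Lemma mcoefU c m n : mcoef (mU c m) n = c *+ (m == n).
Proof. by rewrite fsfunE inE eq_sym; case: eqP. Qed.

Definition madd x y := MonAlg [fsfun m in msupp x `|` msupp y => mcoef x m + mcoef y m | 0].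
Definition mopp x := MonAlg [fsfun m in msupp x => - mcoef x m | 0].
Definition mzero := MonAlg [fsfun].

Lemma mzeroE m : mcoef mzero m = 0. Proof. by rewrite fsfunE. Qed.

Lemma moppE x m : mcoef (mopp x) m = - mcoef x m.
Proof. by rewrite fsfunE; case: ifPn => // /mcoef_out ->; rewrite oppr0. Qed.

Lemma maddE x y m : mcoef (madd x y) m = mcoef x m + mcoef y m.
Proof.
rewrite fsfunE in_fsetU; case: ifPn => //; rewrite negb_or => /andP[].
by move=> /mcoef_out -> /mcoef_out ->; rewrite addr0.
Qed.

Lemma maddA : associative madd.
Proof. by move=> x y z; apply/monAlgP => m; rewrite !maddE addrA. Qed.

Lemma maddC : commutative madd.
Proof. by move=> x y; apply/monAlgP => m; rewrite !maddE addrC. Qed.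

Lemma madd0 : left_id mzero madd.
Proof. by move=> x; apply/monAlgP => m; rewrite maddE mzeroE add0r. Qed.

Lemma maddN : left_inverse mzero mopp madd.
Proof. by move=> x; apply/monAlgP => m; rewrite maddE moppE mzeroE addNr. Qed.

HB.instance Definition _ := GRing.isZmodule.Build monAlg maddA maddC madd0 maddN.

Lemma mcoefD x y m : mcoef (x + y) m = mcoef x m + mcoef y m.
Proof. exact: maddE. Qed.

Lemma mcoef_sum (I : Type) (r : seq I) (P : pred I) (X : I -> monAlg) m :
  mcoef (\sum_(i <- r | P i) X i) m = \sum_(i <- r | P i) mcoef (X i) m.
Proof.
by apply: (big_morph (fun x => mcoef x m)) => [x y|]; [exact: mcoefD|exact: mzeroE].
Qed.

Lemma mU_zmod m : zmod_morphism (mU^~ m).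
Proof.
by move=> c d; apply/monAlgP => n; rewrite maddE moppE !mcoefU mulrnBl.
Qed.

Lemma mU0 m : mU 0 m = 0.
Proof. by rewrite -[in LHS](subrr 0) mU_zmod subrr. Qed.

Lemma mUD c d m : mU (c + d) m = mU c m + mU d m.
Proof. by apply/monAlgP => n; rewrite maddE !mcoefU mulrnDl. Qed.

Lemma monAlgEw D x : msupp x `<=` D -> x = \sum_(m <- D) mU (mcoef x m) m.
Proof.
move=> /fsubsetP xD; apply/monAlgP => n; rewrite mcoef_sum.
have [nD|nD] := boolP (n \in D).
  rewrite (big_fsetD1 n) //= mcoefU eqxx mulr1n big1_fset ?addr0 // => m.
  by rewrite !inE mcoefU => /andP[/negPf ->].
rewrite (mcoef_out (contra (xD n) nD)) big1_fset // => m mD _.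
by rewrite mcoefU; case: eqP nD mD => // -> /negPf ->.
Qed.

Lemma monAlgE x : x = \sum_(m <- msupp x) mU (mcoef x m) m.
Proof. exact/monAlgEw/fsubset_refl. Qed.

Definition mmul x y : monAlg :=
  \sum_(m <- msupp x) \sum_(n <- msupp y) mU (mcoef x m * mcoef y n) (m * n)%g.

Lemma mmulEw D E x y : msupp x `<=` D -> msupp y `<=` E ->
  mmul x y = \sum_(m <- D) \sum_(n <- E) mU (mcoef x m * mcoef y n) (m * n)%g.
Proof.
move=> xD yE; rewrite /mmul (big_fset_incl _ xD) /=; last first.
  by move=> m _ /mcoef_out ->; rewrite big1 // => n _; rewrite mul0r mU0.
apply: eq_bigr => m _; apply: big_fset_incl => // n _ /mcoef_out ->.
by rewrite mulr0 mU0.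
Qed.

Lemma msuppU c m : msupp (mU c m) `<=` [fset m].
Proof.
apply/fsubsetP => n; apply: contraLR; rewrite inE mem_finsupp negbK mcoefU.
by rewrite eq_sym => /negPf ->.
Qed.

Lemma mmulUU c d m n : mmul (mU c m) (mU d n) = mU (c * d) (m * n)%g.
Proof.
by rewrite (mmulEw (msuppU _ _) (msuppU _ _)) !big_seq_fset1 !mcoefU !eqxx.
Qed.

Lemma mmulDl : left_distributive mmul +%R.
Proof.
move=> x y z; pose D := msupp x `|` msupp y `|` msupp (x + y).
have xD : msupp x `<=` D by rewrite /D -fsetUA fsubsetUl.
have yD : msupp y `<=` D by rewrite /D fsetUAC fsubsetUr.
have xyD : msupp (x + y) `<=` D by rewrite /D fsubsetUr.
have zD := fsubset_refl (msupp z).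
rewrite (mmulEw xD zD) (mmulEw yD zD) (mmulEw xyD zD).
rewrite -big_split /=; apply: eq_bigr => m _.
rewrite -big_split /=; apply: eq_bigr => n _.
by rewrite mcoefD mulrDl mUD.
Qed.

Lemma mmulDr : right_distributive mmul +%R.
Proof.
move=> z x y; pose D := msupp x `|` msupp y `|` msupp (x + y).
have xD : msupp x `<=` D by rewrite /D -fsetUA fsubsetUl.
have yD : msupp y `<=` D by rewrite /D fsetUAC fsubsetUr.
have xyD : msupp (x + y) `<=` D by rewrite /D fsubsetUr.
have zD := fsubset_refl (msupp z).
rewrite (mmulEw zD xD) (mmulEw zD yD) (mmulEw zD xyD).
rewrite -big_split /=; apply: eq_bigr => m _.
rewrite -big_split /=; apply: eq_bigr => n _.
by rewrite mcoefD mulrDr mUD.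
Qed.

Lemma mmul0l : left_zero 0 mmul.
Proof. by move=> x; apply: (addrI (mmul 0 x)); rewrite -mmulDl !addr0. Qed.

Lemma mmul0r : right_zero 0 mmul.
Proof. by move=> x; apply: (addrI (mmul x 0)); rewrite -mmulDr !addr0. Qed.

Lemma mmul_suml (I : Type) (r : seq I) (X : I -> monAlg) y :
  mmul (\sum_(i <- r) X i) y = \sum_(i <- r) mmul (X i) y.
Proof. exact: (big_morph (mmul^~ y) (fun _ _ => mmulDl _ _ _) (mmul0l _)). Qed.

Lemma mmul_sumr (I : Type) (r : seq I) (X : I -> monAlg) y :
  mmul y (\sum_(i <- r) X i) = \sum_(i <- r) mmul y (X i).
Proof. exact: (big_morph (mmul y) (fun _ _ => mmulDr _ _ _) (mmul0r _)). Qed.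

Lemma monAlg_ind (P : monAlg -> Prop) :
  P 0 -> (forall x y, P x -> P y -> P (x + y)) -> (forall c m, P (mU c m)) ->
  forall x, P x.
Proof. by move=> P0 PD PU x; rewrite (monAlgE x); apply: big_ind. Qed.

Lemma mmulA : associative mmul.
Proof.
move=> x y z; elim/monAlg_ind: x => [|x x' IH IH'|c m].
- by rewrite !mmul0l.
- by rewrite !mmulDl IH IH'.
elim/monAlg_ind: y => [|y y' IH IH'|d n].
- by rewrite !(mmul0l, mmul0r).
- by rewrite !(mmulDl, mmulDr) IH IH'.
elim/monAlg_ind: z => [|z z' IH IH'|e p].
- by rewrite !mmul0r.
- by rewrite !mmulDr IH IH'.
by rewrite !mmulUU mulrA mulgA.
Qed.

Lemma mmul1l : left_id (mU 1 1%g) mmul.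
Proof.
move=> x; elim/monAlg_ind: x => [|x x' IH IH'|c m]; first exact: mmul0r.
  by rewrite mmulDr IH IH'.
by rewrite mmulUU mul1r mul1g.
Qed.

Lemma mmul1r : right_id (mU 1 1%g) mmul.
Proof.
move=> x; elim/monAlg_ind: x => [|x x' IH IH'|c m]; first exact: mmul0l.
  by rewrite mmulDl IH IH'.
by rewrite mmulUU mulr1 mulg1.
Qed.

HB.instance Definition _ := GRing.Zmodule_isPzRing.Build monAlg
  mmulA mmul1l mmul1r mmulDl mmulDr.

Definition monAlg_kmap c : monAlg := mU c 1%g.

Lemma monAlg_kmap_monoid : monoid_morphism monAlg_kmap.
Proof. by split=> // c d; rewrite /GRing.mul /= mmulUU mulg1. Qed.

Lemma monAlg_kmapC c x : monAlg_kmap c * x = x * monAlg_kmap c.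
Proof.
elim/monAlg_ind: x => [|x x' IH IH'|d m]; first by rewrite mulr0 mul0r.
  by rewrite mulrDl mulrDr IH IH'.
by rewrite /GRing.mul /= !mmulUU mulrC mulg1 mul1g.
Qed.

HB.instance Definition _ := PzRing_isKAlgebra.Build K monAlg
  (mU_zmod 1%g) monAlg_kmap_monoid monAlg_kmapC.

(* The basis element of the monoid algebra attached to [m]. *)
Definition mbase m : monAlg := mU 1 m.

Lemma mbaseM m n : mbase (m * n)%g = mbase m * mbase n.
Proof. by rewrite [RHS]mmulUU mulr1. Qed.

End MonoidAlgebra.

Arguments mbase K {M} m.

(* The linear map [K[M] -> K[M']] extending [f]: a morphism of algebras when
   [f] is a morphism of monoids. *)
Definition monAlg_map (K : comPzRingType) (M M' : monoidType) (f : M -> M')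
    (x : monAlg K M) : monAlg K M' :=
  \sum_(m <- msupp x) mU (mcoef x m) (f m).

Section MonAlgMap.
Local Open Scope fset_scope.
Local Open Scope ring_scope.
Variables (K : comPzRingType) (M M' : monoidType) (f : M -> M').
Hypotheses (f1 : f 1%g = 1%g) (fM : {morph f : m n / (m * n)%g}).
Notation F := (@monAlg_map K M M' f).

Lemma monAlg_mapEw (D : {fset M}) x : msupp x `<=` D ->
  F x = \sum_(m <- D) mU (mcoef x m) (f m).
Proof.
move=> xD; apply: (big_fset_incl _ xD) => m _ /mcoef_out ->; exact: mU0.
Qed.

Lemma monAlg_mapU c m : F (mU c m) = mU c (f m).
Proof. by rewrite (monAlg_mapEw (msuppU _ _)) big_seq_fset1 mcoefU eqxx. Qed.

Lemma monAlg_mapD : {morph F : x y / x + y}.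
Proof.
move=> x y; pose D := msupp x `|` msupp y `|` msupp (x + y).
have xD : msupp x `<=` D by rewrite /D -fsetUA fsubsetUl.
have yD : msupp y `<=` D by rewrite /D fsetUAC fsubsetUr.
have xyD : msupp (x + y) `<=` D by rewrite /D fsubsetUr.
rewrite (monAlg_mapEw xD) (monAlg_mapEw yD) (monAlg_mapEw xyD).
by rewrite -big_split /=; apply: eq_bigr => m _; rewrite mcoefD mUD.
Qed.

Lemma monAlg_map0 : F 0 = 0.
Proof. by apply: (addrI (F 0)); rewrite -monAlg_mapD !addr0. Qed.

Lemma monAlg_mapM : {morph F : x y / x * y}.
Proof.
move=> x y; elim/monAlg_ind: x => [|x x' IH IH'|c m].
- by rewrite !(monAlg_map0, mul0r).
- by rewrite mulrDl !monAlg_mapD mulrDl IH IH'.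
elim/monAlg_ind: y => [|y y' IH IH'|d n].
- by rewrite !(monAlg_map0, mulr0).
- by rewrite mulrDr !monAlg_mapD mulrDr IH IH'.
by rewrite /GRing.mul /= mmulUU !monAlg_mapU mmulUU fM.
Qed.

Lemma monAlg_map_ker_ideal : is_ideal [set x | F x = 0].
Proof.
split=> [|x y /= Fx Fy|a x b /= Fx]; first exact: monAlg_map0.
  by rewrite monAlg_mapD Fx Fy addr0.
by rewrite !monAlg_mapM Fx mulr0 mul0r.
Qed.

Definition monAlg_map_ker : ideal (monAlg K M) := Ideal monAlg_map_ker_ideal.

End MonAlgMap.

Definition free_monoid (X : choiceType) : Type := seq X.

HB.instance Definition _ (X : choiceType) := Choice.on (free_monoid X).
HB.instance Definition _ (X : choiceType) :=
  isMonoid.Build (free_monoid X) (@catA X) (@cat0s X) (@cats0 X).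

Section FreeGroup.
Variable X : choiceType.

(* The letter [(x, false)] stands for [x] and [(x, true)] for [x^-1]. *)
Definition letter : Type := (X * bool)%type.
HB.instance Definition _ := Choice.on letter.

Implicit Types (a b : letter) (u v w : seq letter).

Definition linv a : letter := (a.1, ~~ a.2).

Definition reduced w : bool := sorted (fun a b => b != linv a) w.

Lemma linvK : involutive linv.
Proof. by case=> x b; rewrite /linv negbK. Qed.

(* The reduced form of [a :: w] for [w] reduced. *)
Definition push a w :=
  if w is b :: w' then (if b == linv a then w' else a :: w) else [:: a].

Definition wmul u v := foldr push v u.

Lemma push_reduced a w : reduced w -> reduced (push a w).
Proof.
case: w => //= b w; case: ifPn => [_|ba /= wR]; first exact: path_sorted.
by rewrite ba wR.
Qed.

Lemma pushK a w : reduced w -> push (linv a) (push a w) = w.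
Proof.
case: w => [|b w] /=; first by rewrite linvK eqxx.
have [->|_ _] := eqVneq b (linv a); last by rewrite /= linvK eqxx.
by case: w => //= c w /andP[/negPf ->].
Qed.

Lemma wmul_reduced u v : reduced v -> reduced (wmul u v).
Proof. by move=> vR; elim: u => //= a u; exact: push_reduced. Qed.

Lemma wmul_push a v w : reduced w -> wmul (push a v) w = push a (wmul v w).
Proof.
move=> wR; case: v => //= b v; case: ifPn => // /eqP ->.
by rewrite -{1}[a]linvK pushK // wmul_reduced.
Qed.

Lemma wmulA u v w : reduced w -> wmul u (wmul v w) = wmul (wmul u v) w.
Proof. by move=> wR; elim: u => //= a u ->; rewrite wmul_push. Qed.

Lemma wmulw0 w : reduced w -> wmul w [::] = w.
Proof.
elim: w => //= a [|b w] //= IH /andP[/negPf ba wR].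
by rewrite IH //= ba.
Qed.

Lemma wmulVw w : wmul (rev (map linv w)) w = [::].
Proof.
by elim: w => //= a w IH; rewrite rev_cons /wmul foldr_rcons /= linvK eqxx.
Qed.

Lemma wmulwV w v : reduced v -> wmul w (wmul (rev (map linv w)) v) = v.
Proof.
elim: w v => //= a w IH v vR.
rewrite rev_cons /wmul foldr_rcons -/(wmul _ _) -/(wmul w _) IH ?push_reduced //.
by rewrite -{1}[a]linvK pushK.
Qed.

Record free_group := FreeGroup { fgword : seq letter; _ : reduced fgword }.

HB.instance Definition _ := [isSub for fgword].
HB.instance Definition _ := [Choice of free_group by <:].

Lemma fgwordP (g : free_group) : reduced (fgword g). Proof. exact: valP. Qed.

Definition fg_one : free_group := @FreeGroup [::] isT.
Definition fg_mul (g h : free_group) : free_group :=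
  FreeGroup (wmul_reduced (fgword g) (fgwordP h)).
Definition fg_inv (g : free_group) : free_group :=
  FreeGroup (wmul_reduced (rev (map linv (fgword g))) (fgwordP fg_one)).

Lemma fg_mulA : associative fg_mul.
Proof. by move=> f g h; apply: val_inj; rewrite /= wmulA // fgwordP. Qed.

Lemma fg_mul1 : left_id fg_one fg_mul.
Proof. by move=> g; apply: val_inj. Qed.

Lemma fg_mulr1 : right_id fg_one fg_mul.
Proof. by move=> g; apply: val_inj; rewrite /= wmulw0 // fgwordP. Qed.

Lemma fg_mulV : left_inverse fg_one fg_inv fg_mul.
Proof.
by move=> g; apply: val_inj; rewrite /= -wmulA ?fgwordP //= wmulVw.
Qed.

Lemma fg_mulrV : right_inverse fg_one fg_inv fg_mul.
Proof. by move=> g; apply: val_inj; rewrite /= wmulwV. Qed.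

HB.instance Definition _ := isGroup.Build free_group
  fg_mulA fg_mul1 fg_mulr1 fg_mulV fg_mulrV.

Definition fg_gen (x : X) : free_group := @FreeGroup [:: (x, false)] isT.

Variables (G : groupType) (phi : X -> G).

Definition letter_lift a : G := if a.2 then (phi a.1)^-1%g else phi a.1.

(* The group morphism [free_group -> G] extending [phi]. *)
Definition fg_lift (g : free_group) : G :=
  (\prod_(a <- fgword g) letter_lift a)%g.

Lemma prod_push a w : (\prod_(b <- push a w) letter_lift b =
  letter_lift a * \prod_(b <- w) letter_lift b)%g.
Proof.
case: w => [|b w] /=; first by rewrite big_cons.
case: ifPn => [/eqP ->|_]; last by rewrite big_cons.
rewrite big_cons mulgA [X in (X * _)%g](_ : _ = 1%g) ?mul1g //.
by rewrite /letter_lift /=; case: a.2; rewrite /= (mulgV, mulVg).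
Qed.

Lemma fg_liftM : {morph fg_lift : g h / (g * h)%g}.
Proof.
move=> g h; rewrite /fg_lift /=; elim: (fgword g) => /= [|a w IH].
  by rewrite big_nil mul1g.
by rewrite prod_push IH big_cons mulgA.
Qed.

End FreeGroup.

Arguments fg_gen {X} x.

Section UnitGroup.
Variable F : fieldType.

Record unit_group := UnitGroup { ugval :> F; _ : ugval != 0 }.

HB.instance Definition _ := [isSub for ugval].
HB.instance Definition _ := [Choice of unit_group by <:].

Lemma ugval_neq0 (x : unit_group) : ugval x != 0. Proof. by case: x. Qed.

Fact ug_mul_subproof (x y : unit_group) : ugval x * ugval y != 0.
Proof. by rewrite mulf_neq0 // ugval_neq0. Qed.

Fact ug_inv_subproof (x : unit_group) : (ugval x)^-1 != 0.
Proof. by rewrite invr_neq0 // ugval_neq0. Qed.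

Definition ug_one : unit_group := UnitGroup (oner_neq0 F).
Definition ug_mul x y : unit_group := UnitGroup (ug_mul_subproof x y).
Definition ug_inv x : unit_group := UnitGroup (ug_inv_subproof x).

Lemma ug_mulA : associative ug_mul.
Proof. by move=> x y z; apply: val_inj; rewrite /= mulrA. Qed.
Lemma ug_mul1 : left_id ug_one ug_mul.
Proof. by move=> x; apply: val_inj; rewrite /= mul1r. Qed.
Lemma ug_mulr1 : right_id ug_one ug_mul.
Proof. by move=> x; apply: val_inj; rewrite /= mulr1. Qed.
Lemma ug_mulV : left_inverse ug_one ug_inv ug_mul.
Proof. by move=> x; apply: val_inj; rewrite /= mulVf // ugval_neq0. Qed.
Lemma ug_mulrV : right_inverse ug_one ug_inv ug_mul.
Proof. by move=> x; apply: val_inj; rewrite /= mulfV // ugval_neq0. Qed.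

HB.instance Definition _ := isGroup.Build unit_group
  ug_mulA ug_mul1 ug_mulr1 ug_mulV ug_mulrV.

Lemma ugvalX (x : unit_group) n : ugval (x ^+ n)%g = ugval x ^+ n.
Proof. by elim: n => // n IH; rewrite expgS exprS -IH. Qed.

Record mu (N : nat) := Mu { muval :> unit_group; _ : (muval ^+ N == 1)%g }.

HB.instance Definition _ N := [isSub for @muval N].
HB.instance Definition _ N := [Choice of mu N by <:].

Lemma ug_mulC (x y : unit_group) : (x * y = y * x)%g.
Proof. by apply: val_inj; rewrite /= mulrC. Qed.

Lemma mu_closed N : group_closed (fun x : unit_group => x ^+ N == 1)%g.
Proof.
split=> [|x y]; first by rewrite unfold_in /= expg1n.
rewrite !unfold_in /= => /eqP xN /eqP yN; rewrite expgMn; last exact: ug_mulC.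
by rewrite xN expVgn yN invg1 mulg1.
Qed.

HB.instance Definition _ N :=
  SubChoice_isSubGroup.Build unit_group (fun x => x ^+ N == 1)%g (mu N) (mu_closed N).

End UnitGroup.

Section RootOfUnity.
Variables (R : realType) (N : nat).

Definition expi (t : R) : R[i] := (cos t +i* sin t)%C.

Lemma expi_neq0 t : expi t != 0.
Proof.
apply/eqP => -[c s]; have := cos2Dsin2 t.
by rewrite c s expr0n addr0 => /eqP; rewrite eq_sym oner_eq0.
Qed.

Lemma expiD s t : expi (s + t) = expi s * expi t.
Proof. by rewrite /expi cosD sinD; congr Complex; rewrite addrC. Qed.

Lemma expiX t n : expi t ^+ n = expi (t *+ n).
Proof.
elim: n => [|n IH]; first by rewrite /expi mulr0n cos0 sin0.
by rewrite exprS IH mulrS expiD.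
Qed.

(* [e^{2 pi i / N}] *)
Definition zeta : unit_group R[i] := UnitGroup (expi_neq0 (2 * pi / N%:R)).

Fact zeta_subproof : (zeta ^+ N == 1)%g.
Proof.
apply/eqP/val_inj; rewrite /= ugvalX /= expiX.
have [->|N0] := posnP N; first by rewrite mulr0n /expi cos0 sin0.
rewrite -[_ *+ N]mulr_natr divfK; last by rewrite pnatr_eq0 -lt0n.
by rewrite /expi mulr_natl cos2pi sin2pi.
Qed.

Definition mu_zeta : mu R[i] N := Mu zeta_subproof.

End RootOfUnity.

Section Subalgebra.
Variables (K : comPzRingType) (A : kAlgType K) (u : A).

(* The subalgebra [K + A u] of [A]; in both uses below the sum is direct. *)
Definition in_wsub : pred A := fun x => `[< exists (a : K) (v : A), x = a%:k + v * u >].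

Record wsub := WSub { wsval : A; _ : in_wsub wsval }.

HB.instance Definition _ := [isSub for wsval].
HB.instance Definition _ := [Choice of wsub by <:].

Lemma in_wsub_closed : subring_closed in_wsub.
Proof.
split.
- by apply/asboolP; exists 1, 0; rewrite rmorph1 mul0r addr0.
- move=> x y /asboolP[a [v ->]] /asboolP[b [w ->]]; apply/asboolP.
  by exists (a - b), (v - w); rewrite rmorphB mulrBl opprD addrACA.
- move=> x y /asboolP[a [v ->]] /asboolP[b [w ->]]; apply/asboolP.
  exists (a * b), (v * b%:k + (a%:k + v * u) * w).
  rewrite rmorphM !mulrDl !mulrDr -!mulrA (kmapC b u) !addrA.
  by congr (_ + _); rewrite addrAC.
Qed.

HB.instance Definition _ :=
  GRing.SubChoice_isSubPzRing.Build A in_wsub wsub in_wsub_closed.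

Fact wsub_kmap_subproof (a : K) : in_wsub a%:k.
Proof. by apply/asboolP; exists a, 0; rewrite mul0r addr0. Qed.

Definition wsub_kmap (a : K) : wsub := WSub (wsub_kmap_subproof a).

Lemma wsub_kmap_zmod : zmod_morphism wsub_kmap.
Proof. by move=> a b; apply: val_inj; rewrite raddfB /= rmorphB. Qed.

Lemma wsub_kmap_monoid : monoid_morphism wsub_kmap.
Proof.
by split=> [|a b]; apply: val_inj; rewrite (rmorph1, rmorphM) /= (rmorph1, rmorphM).
Qed.

Lemma wsub_kmapC (a : K) (x : wsub) : wsub_kmap a * x = x * wsub_kmap a.
Proof. by apply: val_inj; rewrite !rmorphM /= kmapC. Qed.

HB.instance Definition _ := PzRing_isKAlgebra.Build K wsub
  wsub_kmap_zmod wsub_kmap_monoid wsub_kmapC.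

Lemma wsval_zmod : zmod_morphism wsval. Proof. exact: (raddfB (val : wsub -> A)). Qed.

Lemma wsvalM (x y : wsub) : wsval (x * y) = wsval x * wsval y.
Proof. exact: (rmorphM (val : wsub -> A)). Qed.

(* The filtration induced on [K + A u] by a filtration of [A]. *)
Variable F : filtration A.

Lemma wsub_fil_ideal m : is_ideal [set x | F m (wsval x)].
Proof.
split=> [|x y|a x b] /=.
- exact: ideal0.
- exact: idealD.
- by move=> Fx; apply/idealMr/idealMl.
Qed.

Definition wsub_fil : filtration wsub :=
  @Filtration K wsub (fun m => Ideal (wsub_fil_ideal m)) (fun m x => @fil_dec _ _ F m (wsval x)).

(* The map induced on completions by the inclusion of [K + A u] in [A]. *)
Definition wsub_compl_map : completion wsub_fil -> completion F :=
  compl_map (F := wsub_fil) wsval_zmod (fun m x => id).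

End Subalgebra.

(* The subspace topology. *)
HB.instance Definition _ (K : comPzRingType) (A : topKAlgType K) (u : A) :=
  Topological.copy (wsub u) (initial_topology (@wsval K A u)).

Lemma ideal_exp_dec (K : comPzRingType) (A : kAlgType K) (I : ideal A) m x :
  ideal_exp I m.+1 x -> ideal_exp I m x.
Proof.
apply: smallest_sub; first exact: idealP.
by move=> _ [y [z [_ Jz ->]]]; exact: idealMl.
Qed.

Definition ideal_adic (K : comPzRingType) (A : kAlgType K) (I : ideal A) :
  filtration A := Filtration (@ideal_exp_dec K A I).

(* [K] is a Q-algebra through [algQ].  The value is meaningful only when the
   exponential series of [x] converges, as it does for [x] of positive degree in
   [VDRhat] below; otherwise [lim] returns a default element. *)
Definition cexp (K : comPzRingType) (algQ : {rmorphism rat -> K})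
    (A : kAlgType K) (F : filtration A) (x : completion F) : completion F :=
  lim (series (fun n => (algQ (n`!%:R)^-1)%:k * x ^+ n) @ \oo).

Section Betti.
Variables (K : comPzRingType) (R : realType) (N : nat).

(* The generators [X_0] and [X_1] of [F_2] are indexed by [false] and [true]. *)
Definition F2 : groupType := free_group bool.

Definition VB : kAlgType K := monAlg K F2.

Definition XB (i : bool) : VB := mbase K (fg_gen i : F2).

Definition X_to_mu (b : bool) : mu R[i] N := if b then 1%g else mu_zeta R N.

(* The kernel of [monAlg_map (fg_lift X_to_mu) : K[F2] -> K[mu_N]]. *)
Definition augB : ideal VB := monAlg_map_ker K (fg_liftM X_to_mu).

Definition VB_fil : filtration VB := ideal_adic augB.

Definition VBhat : topKAlgType K := completion VB_fil.

Definition XBhat (i : bool) : VBhat := compl_in VB_fil (XB i).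

Definition WB : kAlgType K := wsub (XB true - 1).

Definition WB_fil : filtration WB := wsub_fil (XB true - 1) VB_fil.

Definition WBhat : topKAlgType K := completion WB_fil.

Definition jB : WBhat -> VBhat := wsub_compl_map (u := XB true - 1) (F := VB_fil).

End Betti.

Section DeRham.
Variables (K : comPzRingType) (G : finGroupType).

(* The generators: [inl false] is [e_0], [inl true] is [e_1], [inr g] is [g]. *)
Definition DRgen : choiceType := (bool + G)%type.

Definition DRfree : kAlgType K := monAlg K (free_monoid DRgen).

Definition DRletter (x : DRgen) : DRfree :=
  mbase K ([:: x] : free_monoid DRgen).

Local Notation e0 := (DRletter (inl false)).
Local Notation grp g := (DRletter (inr g)).

Definition DRrel : set DRfree := [set x |
  [\/ exists g h : G, x = grp g * grp h - grp (g * h)%g,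
      x = grp 1%g - 1 |
      exists g : G, x = grp g * e0 - e0 * grp g]].

Definition VDR : kAlgType K := quot (ideal_gen DRrel).

Definition DRdeg (w : free_monoid DRgen) : nat :=
  count (fun x => if x is inl _ then true else false) w.

(* [VDR_ge m] is the span of the components of degree at least [m]: the words
   of degree at least [m] are stable under multiplication by any word. *)
Definition VDR_ge (m : nat) : ideal VDR :=
  ideal_gen [set x | exists w, (m <= DRdeg w)%N /\ x = qpi (ideal_gen DRrel) (mbase K w)].

Lemma VDR_ge_dec m x : VDR_ge m.+1 x -> VDR_ge m x.
Proof.
apply: smallest_sub; first exact: idealP.
move=> _ [w [mw ->]] J [_]; apply.
by exists w; split=> //; exact: ltnW.
Qed.

Definition VDR_fil : filtration VDR := Filtration VDR_ge_dec.

(* The degree completion, i.e. the product of the graded components. *)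
Definition VDRhat : topKAlgType K := completion VDR_fil.

Definition DRhat (x : DRgen) : VDRhat :=
  compl_in VDR_fil (qpi (ideal_gen DRrel) (DRletter x)).

Definition ehat (i : bool) : VDRhat := DRhat (inl i).
Definition ghat (g : G) : VDRhat := DRhat (inr g).

Definition WDRhat : topKAlgType K := wsub (ehat true).

Definition jDR : WDRhat -> VDRhat := @wsval K VDRhat (ehat true).

End DeRham.

Arguments VDRhat : clear implicits.
Arguments WDRhat : clear implicits.

Section Comparison.
Variables (R : realType) (K : comPzRingType) (algQ : {rmorphism rat -> K}).
Variables (G : finGroupType) (N : nat).
Variable iota : {multiplicative G -> unit_group R[i]}.

(* The preimage of [e^{2 pi i / N}] under [iota], see [g_iotaE]. *)
Definition g_iota : G := odflt 1%g [pick g : G | iota g == zeta R N].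

Lemma g_iotaE : injective iota -> #|G| = N -> iota g_iota = zeta R N.
Proof.
move=> iota_inj cardG; rewrite /g_iota; case: pickP => [g /eqP //|nz].
pose s := zeta R N :: [seq iota g | g <- enum G].
have us : uniq s.
  rewrite /= map_inj_uniq ?enum_uniq // andbT.
  by apply/negP => /mapP[g _ /eqP]; rewrite eq_sym nz.
have sN x : x \in s -> (x ^+ N = 1)%g.
  rewrite inE => /predU1P[->|/mapP[g _ ->]]; first exact/eqP/(valP (mu_zeta R N)).
  have iotaX n : (iota (g ^+ n) = iota g ^+ n)%g.
    elim: n => [|n IH]; last by rewrite !expgS gmulfM IH.
    by apply: (mulgI (iota 1%g)); rewrite -gmulfM !mulg1.
  by rewrite -iotaX -cardG -cardsT expg_cardG ?inE // (iotaX 0%N).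
have N0 : (0 < N)%N by rewrite -cardG -cardsT cardG_gt0.
have p0 : 'X^N - 1%:P != 0 :> {poly R[i]}.
  by rewrite -size_poly_eq0 size_XnsubC.
have rs : all (root ('X^N - 1%:P : {poly R[i]})) (map val s).
  apply/allP => _ /mapP[x /sN xN ->].
  by rewrite /root !hornerE -ugvalX xN subrr.
have := max_poly_roots p0 rs; rewrite (map_inj_uniq val_inj) => /(_ us).
by rewrite size_XnsubC // size_map /= size_map -cardE cardG ltnn.
Qed.

(* The properties characterizing the comparison isomorphism of [VBhat] with
   [VDRhat]. *)
Definition is_isoV (f : VBhat K R N -> VDRhat K G) : Prop :=
  [/\ top_alg_iso f,
      f (XBhat K R N false) =
        cexp algQ ((algQ N%:R^-1)%:k * ehat K G false) * ghat K g_iota &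
      f (XBhat K R N true) = cexp algQ (ehat K G true)].

End Comparison.

(* Main.v *)
Require Import Defs.
From HB Require Import structures.
From mathcomp Require Import all_boot all_order all_algebra all_fingroup all_solvable.
From mathcomp Require Import complex.
From mathcomp Require Import finmap generic_quotient.
From mathcomp Require Import all_classical all_reals all_analysis.

Set Implicit Arguments.
Unset Strict Implicit.
Unset Printing Implicit Defensive.

Import Order.TTheory GRing.Theory Num.Theory.
Local Open Scope ring_scope.

(** Both completed subalgebras are identified with explicit subsets of the
ambient completed algebras, and these subsets correspond under [isoV].

On the Betti side, the image of [jB] is [K + VBhat (X_1 - 1)].  One inclusion
([wsub_compl_map_lift]) only needs a lift at each level.  The other
([jB_image]) says that this subset is closed, that is, that right
multiplication by [X_1 - 1] is strict for the filtration.  It rests on the Fox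
derivative [fox] with respect to [X_1]: since [D (x y) = x D y + D x aug y] and
[aug] vanishes on the ideal [I] defining the filtration, [D] maps [I^(m+1)] to
[I^m] ([fox_exp]), while [D (v (X_1 - 1)) = v] ([fox_mul_gen1]).  Thus a
Cauchy sequence [a_m + v_m (X_1 - 1)] has constant [a_m] and Cauchy [v_m].

On the de Rham side, [exp e_1 - 1 = u e_1] where [u] is a power series in the
topologically nilpotent [e_1] with constant term [1], hence has a left inverse
([cexp_sub1]).  So [isoV] carries [VBhat (X_1 - 1)] onto [VDRhat e_1], and
[isoW] is the corestriction of [isoV \o jB].  Both completed subalgebras carry
the topology induced by the ambient algebra ([wsub_compl_map_fil] for the Betti
one), so [isoW] inherits bicontinuity from [isoV]. *)

(** * Linear extension from a monoid to its algebra *)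

Section LinearExtension.
Local Open Scope fset_scope.
Local Open Scope ring_scope.
Variables (K : comPzRingType) (M : monoidType) (V : zmodType).
Variable phi : M -> K -> V.
Hypothesis phiD : forall m, {morph phi m : a b / a + b}.

Definition monAlg_ext (x : monAlg K M) : V :=
  \sum_(m <- msupp x) phi m (mcoef x m).

Lemma phi0 m : phi m 0 = 0.
Proof. by apply: (addrI (phi m 0)); rewrite -phiD !addr0. Qed.

Lemma monAlg_extEw (D : {fset M}) x : msupp x `<=` D ->
  monAlg_ext x = \sum_(m <- D) phi m (mcoef x m).
Proof.
move=> xD; apply: (big_fset_incl _ xD) => m _ /mcoef_out ->; exact: phi0.
Qed.

Lemma monAlg_extU c m : monAlg_ext (mU c m) = phi m c.
Proof. by rewrite (monAlg_extEw (msuppU _ _)) big_seq_fset1 mcoefU eqxx. Qed.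

Lemma monAlg_extD : {morph monAlg_ext : x y / x + y}.
Proof.
move=> x y; pose D := msupp x `|` msupp y `|` msupp (x + y).
have xD : msupp x `<=` D by rewrite /D -fsetUA fsubsetUl.
have yD : msupp y `<=` D by rewrite /D fsetUAC fsubsetUr.
have xyD : msupp (x + y) `<=` D by rewrite /D fsubsetUr.
rewrite (monAlg_extEw xD) (monAlg_extEw yD) (monAlg_extEw xyD).
by rewrite -big_split /=; apply: eq_bigr => m _; rewrite mcoefD phiD.
Qed.

Lemma monAlg_ext0 : monAlg_ext 0 = 0.
Proof. by apply: (addrI (monAlg_ext 0)); rewrite -monAlg_extD !addr0. Qed.

Lemma monAlg_extB : {morph monAlg_ext : x y / x - y}.
Proof.
move=> x y; apply: (addIr (monAlg_ext y)).
by rewrite -monAlg_extD !subrK.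
Qed.

End LinearExtension.

(** * The augmentation and the Fox derivatives of the algebra of a free group *)

Section Augmentation.
Variables (K : comPzRingType) (M : monoidType).

Definition aug : monAlg K M -> K := monAlg_ext (fun _ c => c).

Lemma augU c m : aug (mU c m) = c. Proof. exact: monAlg_extU. Qed.

Lemma augD : {morph aug : x y / x + y}. Proof. exact: monAlg_extD. Qed.

Lemma augB : {morph aug : x y / x - y}. Proof. exact: monAlg_extB. Qed.

Lemma aug0 : aug 0 = 0. Proof. exact: monAlg_ext0. Qed.

Lemma augM : {morph aug : x y / x * y}.
Proof.
move=> x y; elim/monAlg_ind: x => [|x x' IH IH'|c m].
- by rewrite mul0r aug0 mul0r.
- by rewrite mulrDl !augD mulrDl IH IH'.
elim/monAlg_ind: y => [|y y' IH IH'|d n].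
- by rewrite mulr0 aug0 mulr0.
- by rewrite mulrDr !augD mulrDr IH IH'.
by rewrite [mU c m * _]mmulUU !augU.
Qed.

Lemma mU_kmap (c : K) (m : M) : mU c m = c%:k * mbase K m.
Proof. by rewrite [RHS]mmulUU mulr1 mul1g. Qed.

Lemma aug_mbase_sub1 (m : M) : aug (mbase K m - 1) = 0.
Proof. by rewrite augB (augU 1 m) (augU 1 1%g) subrr. Qed.

End Augmentation.

Lemma aug_map (K : comPzRingType) (M M' : monoidType) (f : M -> M')
  (x : monAlg K M) : aug (monAlg_map f x) = aug x.
Proof.
elim/monAlg_ind: x => [|x y IHx IHy|c m].
- by rewrite monAlg_map0 !aug0.
- by rewrite monAlg_mapD !augD IHx IHy.
- by rewrite monAlg_mapU !augU.
Qed.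

Section FoxDerivative.
Variables (K : comPzRingType) (X : choiceType) (x0 : X).
Notation A := (monAlg K (free_group X)).

Let fgX (a : letter X) : A :=
  mbase K (letter_lift (fun x => fg_gen x : free_group X) a).

(** The derivative of [x0^-1] has to be [- x0^-1], because that of
[x0 * x0^-1 = 1] vanishes. *)
Definition fox_letter (a : letter X) : A :=
  if a.1 == x0 then (if a.2 then - fgX a else 1) else 0.

Fixpoint fox_word (w : seq (letter X)) : A :=
  if w is a :: w' then fox_letter a + fgX a * fox_word w' else 0.

Lemma fgX_linv a : fgX a * fgX (linv a) = 1.
Proof.
by rewrite -mbaseM; case: a => x [] /=; rewrite /letter_lift /= ?mulgV ?mulVg.
Qed.

Lemma fox_letter_linv a : fox_letter a + fgX a * fox_letter (linv a) = 0.
Proof.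
rewrite /fox_letter /=; case: eqP => _; last by rewrite mulr0 addr0.
by case: a.2 => /=; rewrite ?mulr1 ?addNr // mulrN fgX_linv subrr.
Qed.

(** Cancelling adjacent inverse letters does not change the value, so
[fox_word] is a crossed morphism on the free group. *)
Lemma fox_word_push a w : fox_word (push a w) = fox_letter a + fgX a * fox_word w.
Proof.
case: w => [|b w] //=; case: ifPn => [/eqP ->|//].
by rewrite mulrDr addrA fox_letter_linv add0r mulrA fgX_linv mul1r.
Qed.

Lemma mbase_push a (g : free_group X) :
  mbase K (FreeGroup (push_reduced a (fgwordP g))) = fgX a * mbase K g.
Proof.
rewrite -mbaseM; congr (mbase K _); apply: val_inj => /=.
by case: a => x [].
Qed.

Lemma fox_wordM (g h : free_group X) :
  fox_word (fgword (g * h)%g) =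
  mbase K g * fox_word (fgword h) + fox_word (fgword g).
Proof.
case: g => w wR; rewrite /=.
elim: w wR => [|a w IH] wR.
  rewrite /= addr0 (_ : mbase K _ = 1) ?mul1r //.
  by congr (mbase K _); apply: val_inj.
have w'R : reduced w by exact: path_sorted wR.
rewrite /= fox_word_push (IH w'R) mulrDr addrCA mulrA; congr (_ * _ + _).
rewrite -(mbase_push a (FreeGroup w'R)); congr (mbase K _); apply: val_inj => /=.
by case: (w) wR => //= b v /andP[/negPf ->].
Qed.

(** The derivative [d/dx0], normalized by
[x - aug x = \sum_y (d/dy x) (y - 1)], with the factor [y - 1] on the right. *)
Definition fox : A -> A :=
  monAlg_ext (fun g c => c%:k * fox_word (fgword g)).

Let foxphiD (g : free_group X) : {morph (fun c : K => c%:k * fox_word (fgword g)) : a b / a + b}.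
Proof. by move=> a b; rewrite rmorphD mulrDl. Qed.

Lemma foxU c g : fox (mU c g) = c%:k * fox_word (fgword g).
Proof. exact: (monAlg_extU foxphiD). Qed.
Lemma foxD : {morph fox : x y / x + y}. Proof. exact: (monAlg_extD foxphiD). Qed.
Lemma foxB : {morph fox : x y / x - y}. Proof. exact: (monAlg_extB foxphiD). Qed.
Lemma fox0 : fox 0 = 0. Proof. exact: (monAlg_ext0 foxphiD). Qed.

Lemma foxM x y : fox (x * y) = x * fox y + fox x * (aug y)%:k.
Proof.
elim/monAlg_ind: x => [|x x' IH IH'|c m].
- by rewrite mul0r fox0 !mul0r addr0.
- by rewrite mulrDl !foxD !mulrDl IH IH' addrACA.
elim/monAlg_ind: y => [|y y' IH IH'|d n].
- by rewrite mulr0 fox0 aug0 mulr0 raddf0 mulr0 addr0.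
- by rewrite mulrDr !foxD augD rmorphD !mulrDr IH IH' addrACA.
have -> : mU c m * mU d n = mU (c * d) (m * n)%g by exact: mmulUU.
rewrite (foxU (c * d) (m * n)%g) (foxU d n) (foxU c m) (augU d n).
rewrite fox_wordM (mU_kmap c m) [(c * d)%:k]rmorphM.
move: (mbase K m) (fox_word (fgword n)) (fox_word (fgword m)) => p u v.
by rewrite mulrDr -!mulrA -(kmapC d v) !mulrA -[_ * p * d%:k]mulrA -(kmapC d p) !mulrA.
Qed.

Lemma fox_gen : fox (mbase K (fg_gen x0 : free_group X)) = 1.
Proof. by rewrite foxU rmorph1 mul1r /= /fox_letter /= eqxx mulr0 addr0. Qed.

Lemma fox_kmap (a : K) : fox a%:k = 0.
Proof. by rewrite foxU mulr0. Qed.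

(** Hence the quotient of a right multiple by [x0 - 1] is unique, and [fox]
computes it. *)
Lemma fox_mul_gen1 (v : A) :
  fox (v * (mbase K (fg_gen x0 : free_group X) - 1)) = v.
Proof.
rewrite foxM aug_mbase_sub1 rmorph0 mulr0 addr0 foxB fox_gen.
by rewrite -(rmorph1 (kmap : K -> A)) fox_kmap subr0 rmorph1 mulr1.
Qed.

(** On a product [y z] with [aug z = 0] the Leibniz rule reduces to [y (fox z)],
so the first factor of a product of elements of [I] survives the derivation:
exactly one power of [I] is lost. *)
Lemma fox_exp (I : ideal A) m x : (forall y, I y -> aug y = 0) ->
  ideal_exp I m.+1 x -> ideal_exp I m (fox x).
Proof.
move=> augI; elim: m x => [//|m IH] x.
have aug_exp y : ideal_exp I m.+1 y -> aug y = 0.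
  suff JP : is_ideal [set z : A | aug z = 0]%classic.
    apply: (smallest_sub JP) => _ [z [z' [/augI zI _ ->]]] /=.
    by rewrite augM zI mul0r.
  split=> [|u v|a u b] /=; first exact: aug0.
    by rewrite augD => -> ->; rewrite addr0.
  by rewrite !augM => ->; rewrite mulr0 mul0r.
(* The set of [x] such that [fox x] lies in the smaller power need not be an
   ideal; its intersection with that power is, by the Leibniz rule. *)
suff H : ideal_exp I m.+2 x -> ideal_exp I m.+1 x /\ ideal_exp I m.+1 (fox x).
  by move=> /H[].
pose J := ideal_exp I m.+1; rewrite -/J.
have JP : is_ideal [set z | J z /\ J (fox z)]%classic.
  split=> [|u v [uJ fuJ] [vJ fvJ]|a u b [uJ fuJ]].
  - by split; rewrite ?fox0; apply: ideal0.
  - by split; rewrite ?foxD; apply: idealD.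
  - split; first exact/Defs.idealMr/idealMl.
    rewrite foxM foxM (aug_exp _ uJ) rmorph0 mulr0 addr0.
    by apply: idealD; apply: Defs.idealMr; apply: idealMl.
apply: (smallest_sub JP) => _ [y [z [Iy Jz ->]]].
split; first by apply: idealMl.
rewrite foxM (aug_exp _ Jz) rmorph0 mulr0 addr0 => J' [_]; apply.
by exists y, (fox z); split=> //; exact: IH.
Qed.

End FoxDerivative.

(** * Completions *)

Section CompletionLemmas.
Variables (K : comPzRingType) (A : kAlgType K) (F : filtration A).

Definition cauchy_lim (s : nat -> A) (sF : forall m, F m (s m.+1 - s m)) :
    completion F :=
  @Completion K A F (fun m => qpi (F m) (s m))
    (fun m => etrans (qtransE F m (s m.+1))
      (proj2 (qpiE (F m) (s m.+1) (s m)) (sF m))).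

Lemma fil_repr_succ (x : completion F) m :
  F m (repr (cproj x m.+1) - repr (cproj x m)).
Proof. by apply/qpiE; rewrite qpi_repr; exact: cprojP. Qed.

Section Series.
Variable u : nat -> completion F.
Hypothesis uF : forall m n, (m <= n)%N -> cproj (u n) m = 0.

Lemma cproj_series m n : (m <= n)%N ->
  cproj (\sum_(0 <= i < n) u i) m = cproj (\sum_(0 <= i < m) u i) m.
Proof.
elim: n => [|n IH]; first by rewrite leqn0 => /eqP ->.
rewrite leq_eqVlt => /orP[/eqP -> //|]; rewrite ltnS => mn.
rewrite big_nat_recr //= -IH //.
rewrite -[LHS]/(cproj _ m + cproj (u n) m).
by rewrite uF // addr0.
Qed.

Fact compl_sum_subproof m :
  qtrans ((fun m => cproj (\sum_(0 <= i < m) u i) m) m.+1) =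
  cproj (\sum_(0 <= i < m) u i) m.
Proof. by rewrite cprojP cproj_series. Qed.

Definition compl_sum : completion F := Completion compl_sum_subproof.

Lemma compl_sumE m n : (m <= n)%N ->
  cproj compl_sum m = cproj (\sum_(0 <= i < n) u i) m.
Proof. by move=> mn; rewrite (cproj_series mn). Qed.

(** The limit is determined because the completion is separated: two elements
with the same projections are equal. *)
Lemma lim_series : lim (series u @ \oo)%classic = compl_sum.
Proof.
have cvg_sum : (series u @ \oo --> compl_sum)%classic.
  move=> S [m _ mS]; exists m => // n /= mn; apply: mS.
  exact/esym/compl_sumE.
have cvg_lim : (series u @ \oo --> lim (series u @ \oo))%classic.
  exact: (cvgP _ cvg_sum).
apply: completion_ext => m.
have nL : nbhs (lim (series u @ \oo)%classic)
    [set y | cproj y m = cproj (lim (series u @ \oo)%classic) m]%classic.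
  by exists m.
have [n1 _ n1P] := cvg_lim _ nL.
rewrite (compl_sumE (leq_maxl m n1)); apply/esym.
exact: n1P (leq_maxr _ _).
Qed.

End Series.

(** The inverse is the geometric series in [- y]. *)
Lemma left_inverse_1D (y : completion F) :
  (forall m n, (m <= n)%N -> cproj (y ^+ n) m = 0) ->
  exists z : completion F, z * (1 + y) = 1.
Proof.
move=> yF; have NyF m n : (m <= n)%N -> cproj ((- y) ^+ n) m = 0.
  move=> mn; rewrite exprNn -[LHS]/(cproj _ m * cproj _ m).
  by rewrite yF // mulr0.
exists (compl_sum NyF); apply: completion_ext => m.
rewrite -[LHS]/(cproj _ m * cproj _ m) (compl_sumE NyF (leqnn m)).
rewrite -[LHS]/(cproj (_ * (1 + y)) m).
have -> n : (\sum_(0 <= i < n) (- y) ^+ i) * (1 + y) = 1 - (- y) ^+ n.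
  elim: n => [|n IH]; first by rewrite big_nil mul0r expr0 subrr.
  rewrite big_nat_recr //= mulrDl IH mulrDr mulr1 -[in X in _ * X](opprK y).
  by rewrite mulrN -exprSr addrA subrK.
by rewrite -[LHS]/(cproj 1 m - cproj _ m) NyF // subr0.
Qed.

End CompletionLemmas.

Section SubalgebraCompletion.
Variables (K : comPzRingType) (A : kAlgType K) (u : A) (F : filtration A).
Notation j := (@wsub_compl_map K A u F).
Implicit Types x y : completion (wsub_fil u F).

Lemma wsub_compl_mapE x m (a : wsub u) :
  cproj x m = qpi _ a -> cproj (j x) m = qpi _ (wsval a).
Proof.
move=> xa; apply/qpiE; rewrite -wsval_zmod xa.
exact: (repr_qpi (wsub_fil u F m) a).
Qed.

(** The filtration of [K + A u] is the induced one, so the completion of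
[K + A u] embeds in that of [A] with the subspace topology. *)
Lemma wsub_compl_map_fil x y m :
  cproj (j x) m = cproj (j y) m <-> cproj x m = cproj y m.
Proof.
split=> [xy|xy].
  rewrite -(qpi_repr (cproj x m)) -(qpi_repr (cproj y m)); apply/qpiE.
  by move/qpiE: xy; rewrite -wsval_zmod.
by rewrite (wsub_compl_mapE (esym (qpi_repr (cproj y m)))) /= xy.
Qed.

Lemma wsub_compl_map_inj : injective j.
Proof.
by move=> x y xy; apply: completion_ext => m; apply/wsub_compl_map_fil; rewrite xy.
Qed.

Lemma wsub_compl_map_morphism : alg_morphism j.
Proof.
have E x m := esym (qpi_repr (cproj x m)).
split=> [x y||a].
- apply: completion_ext => m.
  rewrite (@wsub_compl_mapE _ _ (repr (cproj x m) - repr (cproj y m))).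
    by rewrite wsval_zmod qpiD qpiN.
  by rewrite qpiD qpiN !qpi_repr.
- split=> [|x y]; apply: completion_ext => m.
    by rewrite (@wsub_compl_mapE _ _ 1).
  rewrite (@wsub_compl_mapE _ _ (repr (cproj x m) * repr (cproj y m))).
    by rewrite wsvalM qpiM.
  by rewrite qpiM !qpi_repr.
- apply: completion_ext => m.
  by rewrite (@wsub_compl_mapE _ _ a%:k).
Qed.

Lemma wsub_compl_map_continuous : continuous j.
Proof.
move=> x S [m _ mS]; exists m => // y /= yx; apply: mS => /=.
exact/wsub_compl_map_fil.
Qed.

(** If [v_m] represents [v] modulo [F m], the elements [a + v_m u] of [K + A u]
form a Cauchy sequence. *)
Lemma wsub_compl_map_lift (a : K) (v : completion F) :
  exists x, j x = a%:k + v * compl_in F u.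
Proof.
have P (w : A) : in_wsub u (a%:k + w * u) by apply/asboolP; exists a, w.
pose s m := WSub (P (repr (cproj v m))).
have sF m : wsub_fil u F m (s m.+1 - s m).
  rewrite -[wsub_fil _ _ _ _]/(F m (wsval (s m.+1 - s m))).
  rewrite wsval_zmod /= opprD addrACA subrr add0r -mulrBl.
  by apply: Defs.idealMr; exact: fil_repr_succ.
exists (cauchy_lim sF); apply: completion_ext => m.
rewrite (@wsub_compl_mapE _ _ (s m)) //= qpiD qpiM qpi_repr.
by [].
Qed.

End SubalgebraCompletion.

Section BettiImage.
Variables (K : comPzRingType) (R : realType) (N : nat).

(** The augmentation factors through the group algebra of the roots of unity. *)
Lemma aug_augB (y : VB K) : Defs.augB K R N y -> aug y = 0.
Proof. by move=> /= yI; rewrite -(aug_map (fg_lift (X_to_mu R N))) yI aug0. Qed.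

(** Writing the level [m] component of [x] as [a_m + v_m (X_1 - 1)], the
augmentation recovers [a_m] and the Fox derivative recovers [v_m], and both
respect the filtration. *)
Lemma jB_image (x : WBhat K R N) :
  exists a v, jB x = a%:k + v * (XBhat K R N true - 1).
Proof.
pose s m : VB K := wsval (repr (cproj x m)).
have sF m : VB_fil K R N m (s m.+1 - s m).
  by rewrite -wsval_zmod; exact: (fil_repr_succ x).
have sE m : s m = (aug (s m))%:k + fox true (s m) * (XB K true - 1).
  rewrite /s; case: (repr (cproj x m)) => w /= /asboolP[a [v ->]].
  rewrite foxD fox_kmap add0r fox_mul_gen1 augD augM aug_mbase_sub1 mulr0 addr0.
  by rewrite augU.
(* The index is shifted by one to absorb the power of the ideal lost by [fox]. *)
have vF m : VB_fil K R N m (fox true (s m.+2) - fox true (s m.+1)).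
  by rewrite -foxB; exact: (@fox_exp K bool true (Defs.augB K R N) _ _ (@aug_augB) (sF m.+1)).
(* Level [0] of the filtration is the whole algebra, so the augmentation is
   constant only from level [1] on. *)
have aE m : aug (s m.+1) = aug (s 1%N).
  elim: m => // m <-; apply/eqP; rewrite -subr_eq0 -augB; apply/eqP/aug_augB.
  suff H : forall y, VB_fil K R N m.+1 y -> Defs.augB K R N y by exact: H (sF _).
  apply: smallest_sub; first exact: idealP.
  by move=> _ [y [z [yI _ ->]]]; exact: Defs.idealMr.
exists (aug (s 1%N)), (cauchy_lim (F := VB_fil K R N) vF).
apply: completion_ext => m.
rewrite -[LHS]/(qpi _ (s m)).
have -> : qpi (VB_fil K R N m) (s m) = qpi _ (s m.+1).
  by apply/esym/qpiE.
by rewrite sE aE qpiD qpiM qpiD qpiN.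
Qed.

End BettiImage.

(** * Power series in a topologically nilpotent element *)

Section PowerSeries.
Variables (K : comPzRingType) (A : kAlgType K) (F : filtration A).
Variable e : completion F.
Hypothesis eF : forall m n, (m <= n)%N -> cproj (e ^+ n) m = 0.
Implicit Types c : nat -> K.

Lemma pser_term_fil c m n : (m <= n)%N -> cproj ((c n)%:k * e ^+ n) m = 0.
Proof. by move=> mn; rewrite -[LHS]/(cproj _ m * cproj _ m) eF // mulr0. Qed.

Definition pser c : completion F := compl_sum (pser_term_fil c).

Lemma pser_shift c : pser c = (c 0%N)%:k + pser (fun n => c n.+1) * e.
Proof.
apply: completion_ext => m.
rewrite -[RHS]/(cproj _ m + cproj (pser _) m * cproj e m).
rewrite (compl_sumE (pser_term_fil c) (leqnSn m)).
rewrite (compl_sumE (pser_term_fil (fun n => c n.+1)) (leqnn m)) big_nat_recl //.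
rewrite expr0 mulr1 -[RHS]/(cproj (_ + _ * e) m); congr (cproj (_ + _) m).
by rewrite mulr_suml; apply: eq_bigr => i _; rewrite exprSr mulrA.
Qed.

Lemma pser_comm c : GRing.comm (pser c) e.
Proof.
apply: completion_ext => m.
rewrite -[LHS]/(cproj (pser _) m * cproj e m) -[RHS]/(cproj e m * cproj (pser _) m).
rewrite (compl_sumE _ (leqnn m)) -[LHS]/(cproj (_ * e) m) -[RHS]/(cproj (e * _) m).
congr (cproj _ m); rewrite mulr_suml mulr_sumr; apply: eq_bigr => i _.
by rewrite mulrA -kmapC -!mulrA -exprS -exprSr.
Qed.

(** Such a series is [1 + P e] where [P] commutes with [e], so that [P e] is
again topologically nilpotent. *)
Lemma pser_left_inverse c : c 0%N = 1 -> exists z, z * pser c = 1.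
Proof.
move=> c0; rewrite pser_shift c0 rmorph1; apply: left_inverse_1D => m n mn.
rewrite exprMn_comm; last exact: pser_comm.
by rewrite -[LHS]/(cproj _ m * cproj _ m) eF // mulr0.
Qed.

(** The factor [u] is the series [\sum_n e^n / (n + 1)!]. *)
Lemma cexp_sub1 (algQ : {rmorphism rat -> K}) :
  exists u z : completion F, cexp algQ e - 1 = u * e /\ z * u = 1.
Proof.
pose c n := algQ (n`!%:R)^-1.
have [z zu] : exists z, z * pser (fun n => c n.+1) = 1.
  by apply: pser_left_inverse; rewrite /c /= invr1 rmorph1.
exists (pser (fun n => c n.+1)), z; split=> //.
rewrite /cexp (lim_series (pser_term_fil c)) -/(pser c) pser_shift.
by rewrite /c /= invr1 !rmorph1 addrC addKr.
Qed.

End PowerSeries.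

Lemma ehat_fil (K : comPzRingType) (G : finGroupType) (i : bool) m n :
  (m <= n)%N -> cproj (ehat K G i ^+ n) m = 0.
Proof.
move=> mn; pose w : free_monoid (DRgen G) := nseq n (inl i).
have -> : ehat K G i ^+ n =
    compl_in (VDR_fil K G) (qpi (ideal_gen (@DRrel K G)) (mbase K w)).
  rewrite /w; elim: (n) => [|k IH]; first by rewrite expr0.
  rewrite exprS IH; apply: completion_ext => l /=.
  by rewrite -[LHS]qpiM -qpiM -mbaseM.
rewrite -[RHS]qpi0; apply/qpiE; rewrite subr0 => J [_]; apply.
by exists w; split=> //; rewrite /w /DRdeg count_nseq mul1n.
Qed.

(** * The comparison isomorphism *)

Theorem mainTheorem8 (R : realType) (K : comPzRingType)
    (algQ : {rmorphism rat -> K}) (G : finGroupType) (N : nat)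
    (cyclicG : cyclic [set: G]) (cardG : #|G| = N)
    (iota : {multiplicative G -> unit_group R[i]}) (iota_inj : injective iota)
    (isoV : VBhat K R N -> VDRhat K G) (isoVP : is_isoV algQ iota isoV) :
  exists isoW : WBhat K R N -> WDRhat K G,
    top_alg_iso isoW /\ @jDR K G \o isoW = isoV \o @jB K R N.
Proof.
case: isoVP => [[[fB [f1 fM] fk] fC [g [fK gK gC]]] _ fX1].
have [u [z [expE zu]]] := cexp_sub1 (@ehat_fil K G true) algQ.
have fX : isoV (XBhat K R N true - 1) = u * ehat K G true by rewrite fB fX1 f1.
have fD : {morph isoV : x y / x + y}.
  by move=> x y; apply: (addIr (- isoV y)); rewrite -fB !addrK.
have [jBB [jB1 jBM] jBk] :=
  @wsub_compl_map_morphism K (VB K) (XB K true - 1) (VB_fil K R N).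
have im (x : WBhat K R N) : in_wsub (ehat K G true) (isoV (jB x)).
  have [a [v ->]] := jB_image x; apply/asboolP; exists a, (isoV v * u).
  by rewrite fD fk fM fX mulrA.
pose isoW x : WDRhat K G := WSub (im x).
(* [g (v z)] is the right coefficient because
   [(v z) (exp e_1 - 1) = v z u e_1 = v e_1]. *)
have pre (w : WDRhat K G) : exists x, jB x = g (wsval w).
  case: w => w /= /asboolP[a [v ->]].
  have [x jx] := wsub_compl_map_lift (XB K true - 1) (F := VB_fil K R N) a (g (v * z)).
  exists x; apply: (can_inj fK); rewrite gK.
  transitivity (isoV (a%:k + g (v * z) * (XBhat K R N true - 1))).
    by congr isoV; rewrite [LHS]jx; congr (_ + _ * _); apply: completion_ext => m /=; rewrite qpiD qpiN.
  by rewrite fD fk fM gK fX -mulrA [z * _]mulrA zu mul1r.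
pose gW w := projT1 (cid (pre w)).
have gWE w : jB (gW w) = g (wsval w) by exact: projT2 (cid (pre w)).
exists isoW; split; last by [].
split.
- split=> [x y||a].
  + apply: val_inj; rewrite [RHS]wsval_zmod -[LHS]/(isoV (jB _)).
    by rewrite [jB _]jBB fB.
  + split=> [|x y]; apply: val_inj; rewrite -[LHS]/(isoV (jB _)).
      by rewrite [jB _]jB1 f1.
    by rewrite [RHS]wsvalM [jB _]jBM fM.
  + by apply: val_inj; rewrite /= [jB _]jBk fk.
- apply: continuous_comp_initial => x.
  rewrite -[_ \o _]/(isoV \o @jB K R N).
  by apply: continuous_comp; [exact: wsub_compl_map_continuous | exact: fC].
- exists gW; split=> [x|w|].
  + by apply: wsub_compl_map_inj; rewrite [LHS]gWE /= fK.
  + by apply: val_inj; rewrite /= gWE gK.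
  move=> w S [m _ mS].
  have jgC : continuous (@jB K R N \o gW).
    rewrite (_ : _ \o _ = g \o @jDR K G); last exact/funext.
    by move=> v; apply: continuous_comp; [exact: initial_continuous | exact: gC].
  have jS : nbhs (jB (gW w)) [set y | cproj y m = cproj (jB (gW w)) m]%classic.
    by exists m.
  change (nbhs w (gW @^-1` S)%classic).
  apply: (@filterS _ _ (nbhs_filter w) _ _ _ (jgC w _ jS)) => v gvw.
  by apply: mS; apply/wsub_compl_map_fil.
Qed.
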